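(* Let $X$ be a set. The wire $P_{\mathrm c}(X)/[P_{\mathrm c}(X)^2,P_{\mathrm c}(X)^2]$ is the free commutative wire generated by $X$.
   Context: A wire is a triple $(W,\star,\circ)$ with $(W,\star)$ a group, $(W,\circ)$ a semigroup, and $a\circ(b\star c)=(a\circ b)\star a^{-1}\star(a\circ c)$, $(b\star c)\circ a=(b\circ a)\star a^{-1}\star(c\circ a)$ for all $a,b,c\in W$, where $a^{-1}$ is the inverse with respect to $\star$. It is commutative if $\circ$ is commutative. A wire morphism is a map preserving $\star$ and $\circ$. A free commutative wire generated by $X$ is a commutative wire $V$ with a map $\iota\colon X\to V$ such that for every commutative wire $W$ and map $f\colon X\to W$ there is a unique wire morphism $\hat f\colon V\to W$ with $\hat f\iota=f$. Let $M_{\mathrm c}(X)$ be the free commutative semigroup (without identity) generated by $X$, with operation $\circ$, and let $P_{\mathrm c}(X)$ be the free group generated by the set $M_{\mathrm c}(X)$, with operation $\star$ and neutral element $e$. Write elements as $u=\prod_{i=1}^n u_i^{\epsilon_i}=u_1^{\epsilon_1}\star\cdots\star u_n^{\epsilon_n}$ with $u_i\in M_{\mathrm c}(X)$, $\epsilon_i\in\{1,-1\}$ (ordered product, not necessarily reduced). For $l\in M_{\mathrm c}(X)$ put $$l\circ u=l\star\prod_{i=1}^n\bigl(l^{-1}\star(l\circ u_i)\bigr)^{\epsilon_i},\qquad u\circ l=\Bigl(\prod_{i=1}^n\bigl((u_i\circ l)\star l^{-1}\bigr)^{\epsilon_i}\Bigr)\star l.$$ For $u=\prod_{i=1}^n u_i^{\epsilon_i}$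 and $v=\prod_{j=1}^m v_j^{\delta_j}$ put $$u\circ_r v=\Bigl(\prod_{i=1}^n\bigl((u_i\circ v)\star v^{-1}\bigr)^{\epsilon_i}\Bigr)\star v,\qquad u\circ_l v=u\star\prod_{j=1}^m\bigl(u^{-1}\star(u\circ v_j)\bigr)^{\delta_j}.$$ None of these depends on the chosen word representatives. Let $P_{\mathrm c}(X)^2$ be the normal subgroup of $P_{\mathrm c}(X)$ generated by the elements $m^{-1}\star(m\circ l)\star l^{-1}$ for $m,l\in M_{\mathrm c}(X)$. The wire structure on $P_{\mathrm c}(X)/[P_{\mathrm c}(X)^2,P_{\mathrm c}(X)^2]$ is given by the induced $\star$ and $[u]\circ[v]=[u\circ_l v]=[u\circ_r v]$ (the two classes coincide and the operation is well defined); the map from $X$ is $x\mapsto[x]$. *)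

(* Defs.v *)
From HB Require Import structures.
From mathcomp Require Import all_boot monoid.
From mathcomp Require Import finmap multiset.
From mathcomp Require Import boolp classical_sets.

Set Implicit Arguments.
Unset Strict Implicit.
Unset Printing Implicit Defensive.

Local Open Scope group_scope.

Record is_wire (W : groupType) (circ : W -> W -> W) : Prop := IsWire {
  wire_circA : associative circ;
  wire_circMr : forall a b c, circ a (b * c) = circ a b * a^-1 * circ a c;
  wire_circMl : forall a b c, circ (b * c) a = circ b a * a^-1 * circ c a }.

Definition is_commutative_wire (W : groupType) (circ : W -> W -> W) : Prop :=
  is_wire circ /\ commutative circ.

Definition is_wire_morphism (V W : groupType) (circV : V -> V -> V)
    (circW : W -> W -> W) (h : V -> W) : Prop :=
  (forall a b, h (a * b) = h a * h b) /\
  (forall a b, h (circV a b) = circW (h a) (h b)).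

Definition is_free_commutative_wire (X : Type) (V : groupType)
    (circV : V -> V -> V) (iota : X -> V) : Prop :=
  is_commutative_wire circV /\
  forall (W : groupType) (circW : W -> W -> W),
    is_commutative_wire circW ->
    forall f : X -> W,
      exists! fhat : V -> W,
        is_wire_morphism circV circW fhat /\ (fun x => fhat (iota x)) = f.

Section FreeGroup.
Variable S : choiceType.

(* (s, true) stands for s and (s, false) for its inverse. *)
Local Notation letter := (S * bool)%type.

Definition flip (a : letter) : letter := (a.1, ~~ a.2).

Definition reduced (w : seq letter) : bool :=
  sorted (fun a b => b != flip a) w.

Definition push (a : letter) (w : seq letter) : seq letter :=
  if w is b :: w' then if b == flip a then w' else a :: w else [:: a].

Definition reduce (w : seq letter) : seq letter := foldr push [::] w.

Lemma flipK : involutive flip.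
Proof. by case=> s b; rewrite /flip /= negbK. Qed.

Lemma push_reduced a w : reduced w -> reduced (push a w).
Proof.
case: w => [//|b w] /=; case: eqP => [_ /path_sorted //|/eqP ba bw].
by rewrite /reduced /= ba.
Qed.

Lemma foldr_push_reduced z w : reduced z -> reduced (foldr push z w).
Proof. by move=> zr; elim: w => //= a w IH; apply: push_reduced. Qed.

Lemma reduce_reduced w : reduced (reduce w).
Proof. exact: foldr_push_reduced. Qed.

Lemma pushK a w : reduced w -> push (flip a) (push a w) = w.
Proof.
case: w => [|b w] /=; first by rewrite flipK eqxx.
case: eqP => [-> | _ _]; last by rewrite /= flipK eqxx.
by case: w => [//|c w] /= /andP[/negPf->].
Qed.

Lemma pushVK a w : reduced w -> push a (push (flip a) w) = w.
Proof. by move=> wr; rewrite -{1}(flipK a) pushK. Qed.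

Lemma foldr_push z w : reduced z -> foldr push z (reduce w) = foldr push z w.
Proof.
move=> zr; elim: w => //= a w <-.
case: (reduce w) => [//|b v] /=; case: eqP => [->|//].
by rewrite pushVK // foldr_push_reduced.
Qed.

Lemma reduce_id w : reduced w -> reduce w = w.
Proof.
elim: w => //= a w IH aw; rewrite IH; last exact: path_sorted aw.
by case: w aw {IH} => //= b w /andP[/negPf->].
Qed.

Record free_group := FreeGroup { word : seq letter; _ : reduced word }.
HB.instance Definition _ := [isSub for word].
HB.instance Definition _ := [Choice of free_group by <:].

Definition of_word (w : seq letter) : free_group :=
  FreeGroup (reduce_reduced w).

Lemma word_reduced (u : free_group) : reduced (word u).
Proof. by case: u. Qed.

Lemma reduce_cat w1 w2 : reduce (w1 ++ w2) = foldr push (reduce w2) w1.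
Proof. by rewrite /reduce foldr_cat. Qed.

Definition fg_one := of_word [::].
Definition fg_mul u v := of_word (word u ++ word v).
Definition fg_inv u := of_word (rev (map flip (word u))).

Lemma of_wordM w1 w2 : fg_mul (of_word w1) (of_word w2) = of_word (w1 ++ w2).
Proof.
apply: val_inj; rewrite /= !reduce_cat foldr_push ?reduce_reduced //.
by rewrite reduce_id // reduce_reduced.
Qed.

Lemma word_of_word : cancel word of_word.
Proof. by move=> u; apply: val_inj; rewrite /= reduce_id // word_reduced. Qed.

Lemma fg_mulA : associative fg_mul.
Proof.
move=> u v w; rewrite -(word_of_word u) -(word_of_word v) -(word_of_word w).
by rewrite !of_wordM catA.
Qed.

Lemma fg_mul1 : left_id fg_one fg_mul.
Proof. by move=> u; rewrite -(word_of_word u) of_wordM. Qed.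

Lemma fg_mulr1 : right_id fg_one fg_mul.
Proof. by move=> u; rewrite -(word_of_word u) of_wordM cats0. Qed.

Lemma reduce_Vw w : reduce (rev (map flip w) ++ w) = [::].
Proof.
elim: w => //= a w IH; rewrite rev_cons -cats1 -catA /= reduce_cat /=.
by rewrite pushK ?reduce_reduced // -reduce_cat.
Qed.

Lemma fg_mulV : left_inverse fg_one fg_inv fg_mul.
Proof.
move=> u; rewrite -{2}(word_of_word u) of_wordM.
by apply: val_inj; rewrite /= reduce_Vw.
Qed.

Lemma fg_mulrV : right_inverse fg_one fg_inv fg_mul.
Proof.
move=> u; rewrite -{1}(word_of_word u) of_wordM; apply: val_inj => /=.
have {1}-> : word u = rev (map flip (rev (map flip (word u)))).
  by rewrite map_rev revK (mapK flipK).
by rewrite reduce_Vw.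
Qed.

HB.instance Definition _ :=
  isGroup.Build free_group fg_mulA fg_mul1 fg_mulr1 fg_mulV fg_mulrV.

Definition fg_gen (s : S) : free_group := of_word [:: (s, true)].

Section Lift.
Variables (G : groupType) (f : S -> G).

Definition letter_val (a : letter) : G := if a.2 then f a.1 else (f a.1)^-1.

Definition fg_lift (u : free_group) : G := \prod_(a <- word u) letter_val a.

(* Independence of the word representing an element. *)
Lemma fg_lift_of_word w : fg_lift (of_word w) = \prod_(a <- w) letter_val a.
Proof.
rewrite /fg_lift /=; elim: w => //= a w IH; rewrite big_cons -IH.
case: (reduce w) => [|b v] /=; first by rewrite big_cons.
case: eqP => [->|_]; last by rewrite !big_cons.
rewrite big_cons mulgA -[LHS]mul1g; congr (_ * _).
by case: a => s [] /=; rewrite /letter_val /= ?mulgV ?mulVg.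
Qed.

Lemma fg_liftM u v : fg_lift (u * v) = fg_lift u * fg_lift v.
Proof. by rewrite fg_lift_of_word big_cat. Qed.

Lemma fg_lift_gen s : fg_lift (fg_gen s) = f s.
Proof. by rewrite fg_lift_of_word big_seq1. Qed.

End Lift.

Lemma fg_ind (K : free_group -> Prop) :
  (forall s, K (fg_gen s)) -> K 1 -> (forall u v, K u -> K v -> K (u * v)) ->
  (forall u, K u -> K u^-1) -> forall u, K u.
Proof.
move=> Kg K1 KM KV u; rewrite -(word_of_word u).
elim: (word u) => // -[s b] w Kw; rewrite -cat1s -of_wordM; apply: KM => //.
case: b; first exact: Kg.
by have := KV _ (Kg s); congr (K _); apply: val_inj.
Qed.

End FreeGroup.

Arguments fg_gen {S} s.

Section Quotient.
Variable G : groupType.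
Implicit Types (A : set G).

Record is_subgroup A : Prop := IsSubgroup {
  sub1 : A 1;
  subM : forall x y, A x -> A y -> A (x * y);
  subV : forall x, A x -> A x^-1 }.

Definition is_normal A : Prop := forall x y, A x -> A (x ^ y).

Record normal_subgroup := NormalSubgroup {
  nset :> set G;
  nsubP : is_subgroup nset;
  nnormP : is_normal nset }.

Definition generated A : set G :=
  [set x | forall H : set G, is_subgroup H -> (A `<=` H)%classic -> H x].

Lemma generated_subgroup A : is_subgroup (generated A).
Proof.
split=> [H [] //|x y Ax Ay H sH AH|x Ax H sH AH].
  by apply: (subM sH); [apply: Ax | apply: Ay].
by apply: (subV sH); apply: Ax.
Qed.

Lemma sub_generated A : (A `<=` generated A)%classic.
Proof. by move=> x Ax H _; apply. Qed.

Definition normal_closure_set A : set G :=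
  [set x | forall N : normal_subgroup, (A `<=` N)%classic -> nset N x].

Lemma normal_closure_subgroup A : is_subgroup (normal_closure_set A).
Proof.
split=> [N _|x y Ax Ay N AN|x Ax N AN]; first exact: (sub1 (nsubP N)).
  by apply: (subM (nsubP N)); [apply: Ax | apply: Ay].
by apply: (subV (nsubP N)); apply: Ax.
Qed.

Lemma normal_closure_normal A : is_normal (normal_closure_set A).
Proof. by move=> x y Ax N AN; apply: nnormP; apply: Ax. Qed.

Definition normal_closure A : normal_subgroup :=
  NormalSubgroup (normal_closure_subgroup A) (@normal_closure_normal A).

Lemma sub_normal_closure A : (A `<=` normal_closure A)%classic.
Proof. by move=> x Ax N; apply. Qed.

Definition commutators A : set G :=
  [set z | exists x y, [/\ A x, A y & z = [~ x, y]]].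

Lemma derived_normal (N : normal_subgroup) :
  is_normal (generated (commutators N)).
Proof.
move=> x y Nx.
have [g1 gM gV] := generated_subgroup (commutators N).
pose H := [set z | generated (commutators N) (z ^ y)]%classic.
suff: H x by [].
apply: Nx => [|_ [a [b [Na Nb ->]]]]; last first.
  rewrite /H /= conjRg; apply: sub_generated.
  by exists (a ^ y), (b ^ y); split=> //; apply: nnormP.
rewrite /H; split=> /= [|a b Na Nb|a Na]; rewrite ?conj1g ?conjMg ?conjVg //.
  exact: gM.
exact: gV.
Qed.

Definition derived (N : normal_subgroup) : normal_subgroup :=
  NormalSubgroup (generated_subgroup (commutators N)) (@derived_normal N).

Variable N : normal_subgroup.

Definition coset_rel (x y : G) : bool := `[< nset N (x^-1 * y) >].

Lemma coset_rel_refl : reflexive coset_rel.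
Proof. by move=> x; apply/asboolP; rewrite mulVg; apply: (sub1 (nsubP N)). Qed.

Lemma coset_rel_sym : symmetric coset_rel.
Proof.
suff H x y : coset_rel x y -> coset_rel y x by move=> x y; apply/idP/idP; apply: H.
move=> /asboolP /(subV (nsubP N)); rewrite invgM invgK => Nyx.
exact/asboolP.
Qed.

Lemma coset_rel_trans : transitive coset_rel.
Proof.
move=> y x z /asboolP Nxy /asboolP Nyz; apply/asboolP.
by have := subM (nsubP N) Nxy Nyz; rewrite mulgA mulgK.
Qed.

Canonical coset_equiv :=
  EquivRel coset_rel coset_rel_refl coset_rel_sym coset_rel_trans.

Definition quot_group : Type := {eq_quot coset_equiv}%qT.
HB.instance Definition _ := Choice.on quot_group.
HB.instance Definition _ := Quotient.on quot_group.

Definition qproj (x : G) : quot_group := (\pi_quot_group x)%qT.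
Definition qrepr (x : quot_group) : G := repr x.

Lemma qreprK : cancel qrepr qproj.
Proof. exact: reprK. Qed.

Lemma qprojP x y : qproj x = qproj y <-> nset N (x^-1 * y).
Proof.
by split=> [/eqquotP/asboolP|Nxy]; last (apply/eqquotP; apply/asboolP).
Qed.

Definition quot_one := qproj 1.
Definition quot_mul x y := qproj (qrepr x * qrepr y).
Definition quot_inv x := qproj (qrepr x)^-1.

Lemma quot_mulE x y : quot_mul (qproj x) (qproj y) = qproj (x * y).
Proof.
apply/qprojP; set x' := qrepr _; set y' := qrepr _.
have /qprojP Nx : qproj x' = qproj x by rewrite qreprK.
have /qprojP Ny : qproj y' = qproj y by rewrite qreprK.
have := subM (nsubP N) (nnormP y' Nx) Ny; congr (nset N _).
by rewrite /conjg invgM !mulgA mulgK.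
Qed.

Lemma quot_invE x : quot_inv (qproj x) = qproj x^-1.
Proof.
apply/qprojP; set x' := qrepr _; rewrite invgK.
have /qprojP Nx : qproj x = qproj x' by rewrite qreprK.
by have := nnormP x^-1 Nx; rewrite /conjg invgK !mulgA mulgV mul1g.
Qed.

Lemma quot_mulA : associative quot_mul.
Proof.
move=> x y z; rewrite -(qreprK x) -(qreprK y) -(qreprK z).
by rewrite !quot_mulE mulgA.
Qed.
Lemma quot_mul1 : left_id quot_one quot_mul.
Proof. by move=> x; rewrite -(qreprK x) quot_mulE mul1g. Qed.
Lemma quot_mulr1 : right_id quot_one quot_mul.
Proof. by move=> x; rewrite -(qreprK x) quot_mulE mulg1. Qed.
Lemma quot_mulV : left_inverse quot_one quot_inv quot_mul.
Proof. by move=> x; rewrite -(qreprK x) quot_invE quot_mulE mulVg. Qed.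
Lemma quot_mulrV : right_inverse quot_one quot_inv quot_mul.
Proof. by move=> x; rewrite -(qreprK x) quot_invE quot_mulE mulgV. Qed.

HB.instance Definition _ := isGroup.Build quot_group
  quot_mulA quot_mul1 quot_mulr1 quot_mulV quot_mulrV.

Lemma qprojM x y : qproj (x * y) = qproj x * qproj y.
Proof. by rewrite -quot_mulE. Qed.

Lemma qproj1 : qproj 1 = 1.
Proof. by []. Qed.

Lemma qprojV x : qproj x^-1 = (qproj x)^-1.
Proof. by rewrite -quot_invE. Qed.

End Quotient.

Arguments qproj {G} N x.

Section FreeCommutativeSemigroup.
Variable X : Type.

(* The free commutative semigroup on X: non-empty finite multisets under sum. *)
Definition Mc : Type := {m : {mset {classic X}}%mset | m != mset0}.
HB.instance Definition _ := Choice.on Mc.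

Lemma msetD_neq0 (m l : Mc) : (val m `+` val l)%mset != mset0.
Proof.
have /msetP/existsNP[x xm] := elimN eqP (valP m).
apply/eqP => /msetP/(_ x); rewrite msetE2 mset0E => /eqP.
by rewrite addn_eq0 => /andP[/eqP m0 _]; apply: xm; rewrite mset0E.
Qed.

Definition mcirc (m l : Mc) : Mc := exist _ (val m `+` val l)%mset (msetD_neq0 m l).

Lemma mcircC : commutative mcirc.
Proof. by move=> m l; apply: val_inj; rewrite /= msetDC. Qed.

Lemma mset1_neq0 (x : X) : [mset (x : {classic X})]%mset != mset0.
Proof. by apply/eqP => /msetP/(_ x); rewrite msetnxx mset0E. Qed.

Definition mc_gen (x : X) : Mc := exist _ [mset (x : {classic X})]%mset (mset1_neq0 x).

End FreeCommutativeSemigroup.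

Section FreeCommutativeWire.
Variable X : Type.
Implicit Types (m l : Mc X).

Definition Pc : groupType := free_group (Mc X).
Local Notation g := (@fg_gen (Mc X)).
Implicit Types (u v : Pc).

(* [lcirc l u] is $l\circ u$ and [rcirc u l] is $u\circ l$. *)
Definition lcirc l u : Pc :=
  g l * fg_lift (fun m => (g l)^-1 * g (mcirc l m)) u.

Definition rcirc u l : Pc :=
  fg_lift (fun m => g (mcirc m l) * (g l)^-1) u * g l.

Definition circ_r u v : Pc := fg_lift (fun m => lcirc m v * v^-1) u * v.

Definition circ_l u v : Pc := u * fg_lift (fun m => u^-1 * rcirc u m) v.

Definition Pc2 : normal_subgroup Pc :=
  normal_closure
    [set z : Pc | exists m l, z = (g m)^-1 * g (mcirc m l) * (g l)^-1].

Definition wire_quot : groupType := quot_group (derived Pc2).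

(* Independent of the representatives, and also induced by [circ_r]: see
   [wire_circE]. *)
Definition wire_circ (a b : wire_quot) : wire_quot :=
  qproj _ (circ_l (qrepr a) (qrepr b)).

Definition wire_gen (x : X) : wire_quot := qproj _ (g (mc_gen x)).

Local Notation p := (qproj (derived Pc2)).
Let cl u v : Pc := u^-1 * circ_l u v * v^-1.
Let cr u v : Pc := u^-1 * circ_r u v * v^-1.

Lemma lcirc_gen m l : lcirc l (g m) = g (mcirc l m).
Proof. by rewrite /lcirc fg_lift_gen mulVKg. Qed.

Lemma rcirc_gen m l : rcirc (g m) l = g (mcirc m l).
Proof. by rewrite /rcirc fg_lift_gen mulgVK. Qed.

Lemma circ_l_gen u l : circ_l u (g l) = rcirc u l.
Proof. by rewrite /circ_l fg_lift_gen mulVKg. Qed.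

Lemma circ_r_gen m v : circ_r (g m) v = lcirc m v.
Proof. by rewrite /circ_r fg_lift_gen mulgVK. Qed.

Lemma circ_r_genr u l : circ_r u (g l) = rcirc u l.
Proof.
by rewrite /circ_r /rcirc; congr (fg_lift _ u * _); apply/funext=> m;
   rewrite lcirc_gen.
Qed.

Lemma circ_l_genl m v : circ_l (g m) v = lcirc m v.
Proof.
by rewrite /circ_l /lcirc; congr (_ * fg_lift _ v); apply/funext=> l;
   rewrite rcirc_gen.
Qed.

Let cl_crr u l : cl u (g l) = cr u (g l).
Proof. by rewrite /cl /cr circ_l_gen circ_r_genr. Qed.

Let cl_crl m v : cl (g m) v = cr (g m) v.
Proof. by rewrite /cl /cr circ_r_gen circ_l_genl. Qed.

Let clM u v w : cl u (v * w) = cl u v * cl u w ^ v^-1.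
Proof.
by rewrite /cl /circ_l fg_liftM /conjg invgM invgK !mulKg !mulgA mulgVK.
Qed.

Let crM u u' v : cr (u * u') v = cr u v ^ u' * cr u' v.
Proof.
by rewrite /cr /circ_r fg_liftM /conjg invgM !mulgA !mulgK.
Qed.

Let cl1 u : cl u 1 = 1.
Proof.
by have := clM u 1 1; rewrite mulg1 invg1 conjg1 -{1}(mulg1 (cl u 1)) => /mulgI.
Qed.

Let cr1 v : cr 1 v = 1.
Proof.
by have := crM 1 1 v; rewrite mulg1 conjg1 -{1}(mulg1 (cr 1 v)) => /mulgI.
Qed.

Let clV u v : cl u v^-1 = (cl u v)^-1 ^ v.
Proof.
have := clM u v v^-1; rewrite mulgV cl1 => /esym/mulg1_eq ->.
by rewrite conjgKV.
Qed.

Let crV u v : cr u^-1 v = (cr u v)^-1 ^ u^-1.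
Proof.
have := crM u u^-1 v; rewrite mulgV cr1 => /esym/mulg1_eq <-.
by rewrite conjVg.
Qed.

Let in2 (z : Pc) : Prop := nset Pc2 z.
Let in2M x y : in2 x -> in2 y -> in2 (x * y) := @subM _ _ (nsubP Pc2) x y.
Let in2V x : in2 x -> in2 x^-1 := @subV _ _ (nsubP Pc2) x.
Let in2J x y : in2 x -> in2 (x ^ y) := @nnormP _ Pc2 x y.
Let in21 : in2 1 := sub1 (nsubP Pc2).

Let cr_in u v : in2 (cr u v).
Proof.
elim/fg_ind: u => [m||u u' Hu Hu'|u Hu]; last first.
- by rewrite crV; apply/in2J/in2V.
- by rewrite crM; apply: in2M => //; apply: in2J.
- by rewrite cr1.
rewrite -cl_crl; elim/fg_ind: v => [l||v v' Hv Hv'|v Hv]; last first.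
- by rewrite clV; apply/in2J/in2V.
- by rewrite clM; apply: in2M => //; apply: in2J.
- by rewrite cl1.
by apply: sub_normal_closure; exists m, l; rewrite /cl circ_l_genl lcirc_gen.
Qed.

Let cl_in u v : in2 (cl u v).
Proof.
elim/fg_ind: v => [l||v v' Hv Hv'|v Hv]; last first.
- by rewrite clV; apply/in2J/in2V.
- by rewrite clM; apply: in2M => //; apply: in2J.
- by rewrite cl1.
by rewrite cl_crr.
Qed.

Let p2_comm x y : in2 x -> in2 y -> p x * p y = p y * p x.
Proof.
move=> x2 y2; rewrite -!qprojM; apply/esym/qprojP.
rewrite invgM -mulgA; apply: sub_generated; exists x, y; split=> //.
Qed.

Let p2_conj x y : in2 x -> in2 y -> p (x ^ y) = p x.
Proof. by move=> x2 y2; rewrite /conjg 2!qprojM qprojV (p2_comm x2 y2) mulKg. Qed.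

Let commg_in2 u v : in2 [~ u, v].
Proof.
have C w w' : commute w w' -> commute w w'^-1 := @commuteV _ w w'.
pose q := qproj Pc2.
suff /commgP/eqP E : commute (q u) (q v).
  have /qprojP : qproj Pc2 1 = q [~ u, v].
    by rewrite /q /commg /conjg !qprojM !qprojV; symmetry; exact: E.
  by rewrite invg1 mul1g.
have qg m l : q (g (mcirc m l)) = q (g m) * q (g l).
  rewrite -qprojM; apply/esym/qprojP.
  have := @in2J _ (g l) (cl_in (g m) (g l)).
  rewrite /cl circ_l_genl lcirc_gen; congr (in2 _).
  by rewrite /conjg invgM !mulgA mulgVK.
have qgC m l : commute (q (g m)) (q (g l)).
  rewrite /commute -!qg; congr (q (g _)).
  exact: mcircC.
elim/fg_ind: u => [m||u u' Hu Hu'|u Hu]; last first.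
- by rewrite /q qprojV; apply/commute_sym/commuteV/commute_sym.
- by rewrite /q qprojM; apply/commute_sym/commuteM; apply/commute_sym.
- by rewrite /q qproj1; apply/commute_sym/commute1.
elim/fg_ind: v => [l||v v' Hv Hv'|v Hv]; last first.
- by rewrite /q qprojV; apply/commuteV.
- by rewrite /q qprojM; apply/commuteM.
- by rewrite /q qproj1; apply/commute1.
exact: qgC.
Qed.

Let pJC x u v : in2 x -> p ((x ^ u) ^ v) = p ((x ^ v) ^ u).
Proof.
move=> x2; rewrite -!conjgM (commgC u v) conjgM p2_conj //.
exact: in2J.
Qed.

Let pMJ x y u : p ((x * y) ^ u) = p (x ^ u) * p (y ^ u).
Proof. by rewrite conjMg qprojM. Qed.

Let pJ x y u : p x = p y -> p (x ^ u) = p (y ^ u).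
Proof. by move=> xy; rewrite /conjg !qprojM xy. Qed.

Let pV x y : p x = p y -> p x^-1 = p y^-1.
Proof. by move=> xy; rewrite !qprojV xy. Qed.

Let p_crM u v w : p (cr u (v * w)) = p (cr u v * cr u w ^ v^-1).
Proof.
elim/fg_ind: u => [m||u u' Hu Hu'|u Hu].
- by rewrite -!cl_crl clM.
- by rewrite !cr1 conj1g mul1g.
- rewrite !crM; move: (pJ u' Hu) Hu'.
  have := (cr_in u v, cr_in u w, cr_in u' v, cr_in u' w).
  move: (cr u v) (cr u w) (cr u' v) (cr u' w) (cr u (v * w)) (cr u' (v * w)).
  move=> a b c d ab cd [[[a2 b2] c2] d2]; rewrite (conjMg a) (conjMg (b ^ u')).
  rewrite (qprojM _ (ab ^ u')) => -> ->.
  rewrite (qprojM _ (a ^ u' * c)) !(qprojM _ (a ^ u')) (qprojM _ c).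
  rewrite (qprojM _ ((b ^ u') ^ _)) (pJC _ _ b2) -!mulgA; congr (_ * _).
  rewrite !mulgA; congr (_ * _).
  by apply: p2_comm => //; do 2!apply: in2J.
rewrite !crV; have := (cr_in u v, cr_in u w, pJ u^-1 (pV Hu)).
move: (cr u v) (cr u w) => a b [[a2 b2] ->].
rewrite (invgM a) -(conjVg b) pMJ (pJC _ _ (in2V b2)) (qprojM _ (a^-1 ^ _)).
by apply: p2_comm; do ?[apply: in2J | apply: in2V].
Qed.

Let pcr1 u : p (cr u 1) = 1.
Proof.
have := p_crM u 1 1; rewrite mulg1 invg1 conjg1 (qprojM _ (cr u 1)).
by rewrite -{1}(mulg1 (p (cr u 1))) => /mulgI.
Qed.

Let p_clr u v : p (cl u v) = p (cr u v).
Proof.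
elim/fg_ind: v => [l||v w Hv Hw|v Hv].
- by rewrite cl_crr.
- by rewrite cl1 pcr1.
- by rewrite clM p_crM (qprojM _ (cl u v)) (qprojM _ (cr u v)) Hv (pJ v^-1 Hw).
rewrite clV (pJ v (pV Hv)); have := p_crM u v v^-1.
rewrite mulgV pcr1 (qprojM _ (cr u v)) => /esym/mulg1_eq E.
by rewrite (pJ v (y := cr u v^-1 ^ v^-1)) ?conjgKV // qprojV.
Qed.

Lemma circ_lr u v : p (circ_l u v) = p (circ_r u v).
Proof.
have -> : circ_l u v = u * cl u v * v by rewrite /cl !mulgA mulgV mul1g mulgVK.
have -> : circ_r u v = u * cr u v * v by rewrite /cr !mulgA mulgV mul1g mulgVK.
by rewrite !(qprojM _ (u * _)) !(qprojM _ u) p_clr.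
Qed.

Let derived_in2 n : nset (derived Pc2) n -> in2 n.
Proof.
apply; first exact: (nsubP Pc2).
move=> _ [a [b [a2 b2 ->]]]; rewrite commgEl; apply: in2M; first exact: in2V.
exact: in2J.
Qed.

Let circ_r_derived u n v :
  nset (derived Pc2) n -> p (circ_r (u * n) v) = p (circ_r u v).
Proof.
move=> dn; have n2 := derived_in2 dn.
have pn : p n = 1 by rewrite -qproj1; apply/esym/qprojP; rewrite invg1 mul1g.
have E w : circ_r w v = w * cr w v * v by rewrite /cr !mulgA mulgV mul1g mulgVK.
have crM2 x y : in2 x -> in2 y -> p (cr (x * y) v) = p (cr x v) * p (cr y v).
  by move=> x2 y2; rewrite crM (qprojM _ (cr x v ^ y)) p2_conj.
have crn : p (cr n v) = 1.
  pose H := [set z | in2 z /\ p (cr z v) = 1]%classic.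
  suff [] : H n by [].
  have sH : is_subgroup H.
    split=> [|x y [x2 x1] [y2 y1]|x [x2 x1]]; split=> //.
    - by rewrite cr1 -qproj1.
    - exact: in2M.
    - by rewrite crM2 // x1 y1 mulg1.
    - exact: in2V.
    have := crM2 _ _ x2 (in2V x2).
    by rewrite mulgV cr1 x1 mul1g qproj1 => <-.
  apply: dn => // _ [a [b [a2 b2 ->]]]; split=> //.
  have crV2 x : in2 x -> p (cr x^-1 v) = (p (cr x v))^-1.
    move=> x2; apply/esym/mulg1_eq; rewrite -crM2 //; last exact: in2V.
    by rewrite mulgV cr1.
  have [ai bi] := (in2V a2, in2V b2); have ab := in2M a2 b2.
  rewrite /commg /conjg !crM2 ?crV2 //; last exact: in2M.
  by rewrite (p2_comm (cr_in a v)) // mulKg mulVg.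
rewrite !E crM (qprojM _ (u * n * _)) (qprojM _ (u * n)) (qprojM _ u n) pn.
rewrite (qprojM _ (u * _)) (qprojM _ u) mulg1; congr (_ * _ * _).
by rewrite (qprojM _ (cr u v ^ n)) crn mulg1 p2_conj.
Qed.

Lemma fg_lift_conj (f h : Mc X -> Pc) x u : f =1 h ->
  x * fg_lift (fun m => x^-1 * f m) u = fg_lift (fun m => h m * x^-1) u * x.
Proof.
move/funext=> <-.
elim/fg_ind: u => [m||u v Hu Hv|u Hu].
- by rewrite !fg_lift_gen mulVKg mulgVK.
- by rewrite /fg_lift !big_nil mulg1 mul1g.
- by rewrite !fg_liftM mulgA Hu -mulgA Hv mulgA.
have lV k : fg_lift k u^-1 = (fg_lift k u)^-1 :> Pc.
  by apply/esym/mulg1_eq; rewrite -fg_liftM mulgV /fg_lift big_nil.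
rewrite !lV; apply: (@mulIg _ (fg_lift (fun m => x^-1 * f m) u)).
by rewrite mulgVK -mulgA Hu mulKg.
Qed.

Lemma rcircE u l : rcirc u l = lcirc l u.
Proof. by apply/esym/fg_lift_conj => m; rewrite mcircC. Qed.

Lemma circ_l_circ_r u v : circ_l u v = circ_r v u.
Proof. by apply: fg_lift_conj => m; rewrite rcircE. Qed.

Lemma wire_circE u v :
  wire_circ (p u) (p v) = p (circ_l u v) /\
  wire_circ (p u) (p v) = p (circ_r u v).
Proof.
suff E : wire_circ (p u) (p v) = p (circ_l u v) by rewrite -circ_lr.
have D w : exists2 n, nset (derived Pc2) n & qrepr (p w) = w * n.
  exists (w^-1 * qrepr (p w)); last by rewrite mulVKg.
  by apply/qprojP; rewrite qreprK.
rewrite /wire_circ; have [[n dn ->] [n' dn' ->]] := (D u, D v).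
rewrite circ_lr circ_r_derived // -circ_lr circ_l_circ_r circ_r_derived //.
by rewrite -circ_l_circ_r.
Qed.

End FreeCommutativeWire.

(* Main.v *)
(* In any wire 1 is neutral for circ, and both a o - and - o a are affine: they
   satisfy F (x * y) = F x * c^-1 * F y with c = F 1 = a.  Two affine maps with
   the same constant agree on a subgroup, so associativity of circ on the
   quotient and compatibility of a homomorphism with circ need only be checked
   on the classes of the generators m in M_c(X), where circ is the free
   commutative semigroup law.

   A map f : X -> W extends to M_c(X) by circ-products and then to a group
   homomorphism on P_c(X).  It factors through the quotient because the elements
   a^-1 * (a o b) * b^-1 of a commutative wire commute with each other (expand
   (a * b) o (c * d) in two ways) and so do their conjugates. *)

Require Import Defs.
From HB Require Import structures.
From mathcomp Require Import all_boot monoid.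
From mathcomp Require Import finmap multiset.
From mathcomp Require Import boolp classical_sets.

Set Implicit Arguments.
Unset Strict Implicit.
Unset Printing Implicit Defensive.

Local Open Scope group_scope.

(** * Affine maps between groups *)

Definition affine (G H : groupType) (c : H) (F : G -> H) : Prop :=
  forall x y, F (x * y) = F x * c^-1 * F y.

Lemma affine1 (G H : groupType) (c : H) (F : G -> H) : affine c F -> F 1 = c.
Proof.
move=> aF; have := aF 1 1; rewrite mulg1 -mulgA -{1}(mulg1 (F 1)).
by move=> /mulgI/esym/mulg1_eq; rewrite invgK.
Qed.

Lemma affineV (G H : groupType) (c : H) (F : G -> H) x :
  affine c F -> F x^-1 = c * (F x)^-1 * c.
Proof.
move=> aF; have := aF x x^-1; rewrite mulgV (affine1 aF) => E.
by rewrite {2}E !mulgA mulgVK mulgV mul1g.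
Qed.

(** The constant is the value of the composite at 1, namely [F (E 1) = F d]. *)
Lemma affine_comp (G H K : groupType) (d : H) (c : K) (F : H -> K) (E : G -> H) :
  affine c F -> affine d E -> affine (F d) (F \o E).
Proof.
by move=> aF aE x y; rewrite /= aE !aF (affineV _ aF) !mulgA mulgVK mulgK.
Qed.

Lemma affine_eq_subgroup (G H : groupType) (c : H) (F F' : G -> H) :
  affine c F -> affine c F' -> is_subgroup [set x | F x = F' x].
Proof.
move=> aF aF'; split=> /= [|x y Ex Ey|x Ex]; first by rewrite !(@affine1 _ _ c).
  by rewrite aF aF' Ex Ey.
by rewrite (affineV _ aF) (affineV _ aF') Ex.
Qed.

Lemma hom_affine (G H : groupType) (h : G -> H) :
  (forall x y, h (x * y) = h x * h y) -> affine 1 h.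
Proof. by move=> hM x y; rewrite invg1 mulg1. Qed.

(** * Homomorphisms that kill the derived subgroup of a normal closure *)

Section KernelOfDerived.
Variables (G H : groupType).

Definition centraliser (A : set G) : set G :=
  [set x | forall y, A y -> commute x y].

Lemma centraliser_subgroup A : is_subgroup (centraliser A).
Proof.
split=> [y _|x y Cx Cy z Az|x Cx z Az]; apply/commute_sym.
- exact: commute1.
- by apply: commuteM; apply/commute_sym; [apply: Cx | apply: Cy].
- exact/commuteV/commute_sym/Cx.
Qed.

Lemma centraliser_normal A : is_normal A -> is_normal (centraliser A).
Proof.
move=> nA x y Cx z Az; apply: (@conjg_inj _ y^-1).
by rewrite (conjMg (x ^ y)) (conjMg z) conjgK; apply/Cx/nA.
Qed.

Variable h : H -> G.
Hypothesis hM : forall x y, h (x * y) = h x * h y.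

Lemma hom1 : h 1 = 1.
Proof. exact: affine1 (hom_affine hM). Qed.

Lemma homV x : h x^-1 = (h x)^-1.
Proof. by rewrite (affineV _ (hom_affine hM)) mul1g mulg1. Qed.

Lemma normal_closure_hom (S : set H) (N : set G) :
  is_subgroup N -> is_normal N -> (forall x, S x -> N (h x)) ->
  forall x, nset (normal_closure S) x -> N (h x).
Proof.
move=> [N1 NM NV] nN SN x Sx.
have sP : is_subgroup [set y | N (h y)].
  split=> /= [|y z|y]; rewrite ?hom1 ?hM ?homV //; first exact: NM.
  exact: NV.
have nP : is_normal [set y | N (h y)].
  by move=> y z Ny; rewrite /= /conjg !hM homV; apply: nN.
exact: (Sx (NormalSubgroup sP nP)).
Qed.

(** Since [A] is commutative, it lies in its centraliser and, as always, in its double centraliser.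
    Both are normal subgroups, so [h] maps the whole normal closure into each of them, and elements
    of the two commute. *)
Lemma hom_derived1 (S : set H) (A : set G) :
  is_normal A -> (forall a b, A a -> A b -> commute a b) ->
  (forall x, S x -> A (h x)) ->
  forall x, nset (derived (normal_closure S)) x -> h x = 1.
Proof.
move=> nA cA SA x Sx.
have C1 y : nset (normal_closure S) y -> centraliser A (h y).
  apply: normal_closure_hom; first exact: centraliser_subgroup.
    exact: centraliser_normal.
  by move=> z /SA Az b Ab; apply: cA.
have C2 y : nset (normal_closure S) y -> centraliser (centraliser A) (h y).
  apply: normal_closure_hom; first exact: centraliser_subgroup.
    exact/centraliser_normal/centraliser_normal.
  by move=> z /SA Az b Cb; apply/commute_sym/Cb.
suff: [set y | h y = 1]%classic x by []; apply: Sx.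
  split=> /= [|y z|y]; rewrite ?hom1 ?hM ?homV //; first by move=> -> ->; rewrite mulg1.
  by move=> ->; rewrite invg1.
move=> _ [y [z [Sy Sz ->]]] /=; rewrite /commg /conjg !hM !homV.
by rewrite -(C2 _ Sz _ (C1 _ Sy)) mulKg mulVg.
Qed.

End KernelOfDerived.

(** * Defects in a commutative wire and extension of maps to the free commutative semigroup *)

Section CommutativeWire.
Variables (W : groupType) (circ : W -> W -> W).
Hypotheses (wireW : is_wire circ) (circC : commutative circ).

Lemma circ_affinel a : affine a (circ a).
Proof. exact: wire_circMr. Qed.

Lemma circ1 : left_id 1 circ.
Proof. by move=> a; rewrite circC (affine1 (circ_affinel a)). Qed.

Definition defect a b : W := a^-1 * circ a b * b^-1.

Lemma defect_commute a b c d : commute (defect c b) (defect a d).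
Proof.
have [_ Mr Ml] := wireW.
have := Mr (a * b) c d; rewrite !Ml Mr (Mr b) => E.
(* Both expansions start with [circ a c] and end with [circ b d]; between them stand the two
   products of defects. *)
apply: (@mulgI _ (circ a c)); apply: (@mulIg _ (circ b d)).
rewrite /defect (circC c b); move: E.
by rewrite !invgM !mulgA.
Qed.

(** Conjugates of defects become products of defects and their inverses, so their commutation
    reduces to [defect_commute]. *)
Lemma defectJ a b y : defect a b ^ y^-1 = (defect a y)^-1 * defect a (y * b).
Proof.
rewrite /defect /conjg (wire_circMr wireW) !invgM !invgK !mulgA.
by rewrite mulgK mulgVK.
Qed.

Definition defect_conjugates : set W :=
  [set z | exists a b y, z = defect a b ^ y].

Lemma defect_conjugates_normal : is_normal defect_conjugates.
Proof. by move=> _ y [a [b [z ->]]]; exists a, b, (z * y); rewrite conjgM. Qed.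

Lemma defect_conjugates_commute x y :
  defect_conjugates x -> defect_conjugates y -> commute x y.
Proof.
move=> [a [b [s ->]]] [c [d [t ->]]].
rewrite -(invgK s) -(invgK t) !defectJ.
have D e f e' f' : commute (defect e f)^-1 (defect e' f').
  exact/commute_sym/commuteV/defect_commute.
apply: commuteM; apply/commute_sym; apply: commuteM; apply/commute_sym => //.
- exact: commuteV.
- exact/commuteV/defect_commute.
- exact: defect_commute.
Qed.

HB.instance Definition _ :=
  Monoid.isComLaw.Build W 1 circ (wire_circA wireW) circC circ1.

Variables (X : Type) (f : X -> W).

(** The multiset is enumerated in some order, which is harmless by commutativity; the default value
    1 is neutral for [circ]. *)
Definition mc_lift (m : Mc X) : W := \big[circ/1]_(x <- val m) f x.

Lemma mc_lift_gen x : mc_lift (mc_gen x) = f x.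
Proof. by rewrite /mc_lift /= enum_msetn big_seq1. Qed.

Lemma perm_msetD (K : choiceType) (A B : {mset K}%mset) :
  perm_eq (A `+` B)%mset (A ++ B).
Proof.
by apply/allP => x _ /=; rewrite count_cat !count_mem_mset msetE2.
Qed.

Lemma mc_lift_circ m l : mc_lift (mcirc m l) = circ (mc_lift m) (mc_lift l).
Proof. by rewrite /mc_lift (perm_big _ (perm_msetD _ _)) big_cat. Qed.

End CommutativeWire.

(** * The wire laws on the quotient and its universal property *)

Section FreeCommutativeWire.
Variable X : Type.
Local Notation g := (@fg_gen (Mc X)).
Local Notation p := (qproj (derived (Pc2 X))).

Lemma mc_ind (K : Mc X -> Prop) :
  (forall x, K (mc_gen x)) -> (forall m l, K m -> K l -> K (mcirc m l)) ->
  forall m, K m.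
Proof.
move=> Kg Kc; suff Ks (s : seq {classic X}) (m : Mc X) : val m = seq_mset s -> K m.
  by move=> m; apply: (Ks (val m)); rewrite seq_mset_id.
elim: s m => [|x s IH] m Em.
  by have /eqP[] := valP m; rewrite Em; apply/msetP => x; rewrite mset_seqE mset0E.
have {}Em : val m = ([mset x] `+` seq_mset s)%mset.
  by rewrite Em; apply/msetP => y; rewrite mset1DE !mset_seqE /= eq_sym.
(* An empty tail is not an element of [Mc X]; in that case [m] is itself a generator. *)
have [s0|s0] := eqVneq (seq_mset s) mset0.
  by rewrite (_ : m = mc_gen x) //; apply: val_inj; rewrite Em s0 msetD0.
pose l : Mc X := exist (fun A => A != mset0) (seq_mset s) s0.
rewrite (_ : m = mcirc (mc_gen x) l); last exact: val_inj.
by apply: Kc => //; apply: IH.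
Qed.

Lemma wire_quot_ind (N : set (wire_quot X)) :
  is_subgroup N -> (forall m, N (p (g m))) -> forall a, N a.
Proof.
move=> [N1 NM NV] Ng a; rewrite -(qreprK a).
elim/fg_ind: (qrepr a) => // [u v Nu Nv|u Nu]; first by rewrite qprojM; apply: NM.
by rewrite qprojV; apply: NV.
Qed.

Lemma wire_quot_affine_eq (G : groupType) (c : G) (F F' : wire_quot X -> G) :
  affine c F -> affine c F' -> (forall m, F (p (g m)) = F' (p (g m))) ->
  forall a, F a = F' a.
Proof.
by move=> aF aF'; apply: wire_quot_ind (affine_eq_subgroup aF aF').
Qed.

Lemma wire_circ_gen m l : wire_circ (p (g m)) (p (g l)) = p (g (mcirc m l)).
Proof. by rewrite (wire_circE _ _).1 circ_l_gen rcirc_gen. Qed.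

Lemma wire_circC : commutative (@wire_circ X).
Proof.
move=> a b; rewrite -(qreprK a) -(qreprK b).
by rewrite (wire_circE _ _).1 (wire_circE _ _).2 circ_l_circ_r.
Qed.

Lemma wire_circ_affine (a : wire_quot X) : affine a (wire_circ a).
Proof.
move=> b c; rewrite -(qreprK a) -(qreprK b) -(qreprK c).
move: (qrepr a) (qrepr b) (qrepr c) => u v w; rewrite -(qprojM _ v).
rewrite !(wire_circE _ _).1 (_ : circ_l u (v * w) = circ_l u v * u^-1 * circ_l u w).
  by rewrite (qprojM _ (_ * u^-1)) (qprojM _ _ u^-1) qprojV.
by rewrite /circ_l fg_liftM !mulgA mulgVK.
Qed.

Lemma wire_circ_affiner (a : wire_quot X) : affine a ((@wire_circ X)^~ a).
Proof. by move=> b c; rewrite /= !(wire_circC _ a) wire_circ_affine. Qed.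

(** The variables are reduced to generators one at a time. At each stage both sides are affine with
    the same constant, for instance [wire_circ b c] as maps of [a]. *)
Lemma wire_circA : associative (@wire_circ X).
Proof.
move=> a b c; move: a; apply: wire_quot_affine_eq => [||m].
- exact: wire_circ_affiner.
- exact: affine_comp (wire_circ_affiner c) (wire_circ_affiner b).
move: b; apply: wire_quot_affine_eq => [||l].
- exact: affine_comp (wire_circ_affine _) (wire_circ_affiner c).
- exact: affine_comp (wire_circ_affiner c) (wire_circ_affine _).
move: c; apply: wire_quot_affine_eq => [||k].
- exact: affine_comp (wire_circ_affine _) (wire_circ_affine _).
- exact: wire_circ_affine.
rewrite !wire_circ_gen; congr (p (g _)).
by apply: val_inj; rewrite /= msetDA.
Qed.

Lemma wire_circ_commutative_wire : is_commutative_wire (@wire_circ X).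
Proof.
split; last exact: wire_circC.
by split; [exact: wire_circA | exact: wire_circ_affine | exact: wire_circ_affiner].
Qed.

Lemma wire_hom_circ (W : groupType) (circ : W -> W -> W) (h : wire_quot X -> W) :
  is_wire circ -> (forall a b, h (a * b) = h a * h b) ->
  (forall m l, h (p (g (mcirc m l))) = circ (h (p (g m))) (h (p (g l)))) ->
  forall a b, h (wire_circ a b) = circ (h a) (h b).
Proof.
move=> [_ Mr Ml] hM hg a b; have ah := hom_affine hM.
(* Neutrality of 1 matches the constants below: [affine_comp] yields [circ 1 (h b)] on the right,
   against [h b] on the left. *)
have c1 x : circ x 1 = x by apply: affine1 (Mr x).
have c1l x : circ 1 x = x by apply: (affine1 (F := circ^~ x)) => y z; apply: Ml.
move: a; apply: (@wire_quot_affine_eq _ (h b)) => [||m].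
- exact: affine_comp ah (wire_circ_affiner b).
- rewrite -{1}(c1l (h b)); apply: (affine_comp (F := circ^~ (h b)) _ ah).
  by move=> x y; apply: Ml.
move: b; apply: (@wire_quot_affine_eq _ (h (p (g m)))) => [||l].
- exact: affine_comp ah (wire_circ_affine _).
- by rewrite -{1}(c1 (h _)); apply: (affine_comp (Mr _) ah).
by rewrite wire_circ_gen hg.
Qed.

Lemma wire_morphism_eq (W : groupType) (circ : W -> W -> W)
    (h k : wire_quot X -> W) :
  is_wire_morphism (@wire_circ X) circ h ->
  is_wire_morphism (@wire_circ X) circ k ->
  h \o @wire_gen X = k \o @wire_gen X -> h = k.
Proof.
move=> [hM hc] [kM kc] E; apply/funext.
apply: (wire_quot_affine_eq (hom_affine hM) (hom_affine kM)) => m.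
elim/mc_ind: m => [x|m l Em El]; first exact: (congr1 (@^~ x) E).
by rewrite -wire_circ_gen /= hc kc Em El.
Qed.

Lemma wire_lift (W : groupType) (circ : W -> W -> W) (f : X -> W) :
  is_commutative_wire circ ->
  exists2 h, is_wire_morphism (@wire_circ X) circ h & h \o @wire_gen X = f.
Proof.
move=> [wireW circC].
pose F := mc_lift circ f; pose Phi : Pc X -> W := fg_lift F.
have PhiM : forall x y, Phi (x * y) = Phi x * Phi y := fg_liftM F.
have Phi1 n : nset (derived (Pc2 X)) n -> Phi n = 1.
  apply: (hom_derived1 PhiM (@defect_conjugates_normal _ circ)).
    exact: defect_conjugates_commute.
  (* A generator of [Pc2] is sent to the defect of [F m] and [F l], conjugated trivially. *)
  move=> _ [m [l ->]]; exists (F m), (F l), 1.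
  by rewrite conjg1 !PhiM !(homV PhiM) /Phi !fg_lift_gen /F mc_lift_circ.
pose h (a : wire_quot X) := Phi (qrepr a).
(* The choice of representative in [h] is immaterial because [Phi] is trivial on the derived
   subgroup. *)
have hp u : h (p u) = Phi u.
  have /qprojP/Phi1 : p u = p (qrepr (p u)) by rewrite qreprK.
  by rewrite PhiM (homV PhiM) => /mulg1_eq; rewrite invgK.
have hM a b : h (a * b) = h a * h b.
  by rewrite -{1}(qreprK a) -{1}(qreprK b) -qprojM hp PhiM.
exists h; last first.
  by apply/funext => x; rewrite /= hp /Phi fg_lift_gen /F mc_lift_gen.
split=> //; apply: wire_hom_circ => // m l.
by rewrite !hp /Phi !fg_lift_gen /F mc_lift_circ.
Qed.

End FreeCommutativeWire.

Theorem proposition4p4 (X : Type) :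
  is_free_commutative_wire (@wire_circ X) (@wire_gen X).
Proof.
split=> [|W circW wireW f]; first exact: wire_circ_commutative_wire.
have [h mh hf] := wire_lift f wireW.
by exists h; split=> // k [mk kf]; apply: wire_morphism_eq mh mk _; rewrite hf.
Qed.
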